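(* Let $x\in\mathbb C$ and $\vec\Lambda\in\mathbb C^n[2\mathfrak m]$ be generic. Then for any vector $\psi^{(0)}=\sum_{\vec m\in\mathcal Z^n[\mathfrak m]}\psi^{(0)}_{\vec m}\,v^{(\vec m)}\in V_{n,\mathfrak m}$ there exists a unique function $\psi(\lambda)$ of the form $$\psi(\lambda)=q^{\lambda(x-\mathfrak m)}\Big(\sum_{k=0}^{\mathfrak m}q^{2k\lambda}\,\psi^{(k)}\Big),\qquad \psi^{(k)}\in V_{n,\mathfrak m},$$ with the given initial coefficient $\psi^{(0)}$, satisfying the $n$-point resonance relations with respect to $\vec\Lambda$.
   Context: Fix $\eta\in\mathbb C$ with $\operatorname{Im}\eta>0$ and put $q^x=e^{\pi i\eta x}$ for $x\in\mathbb C$. Fix integers $\mathfrak m\ge 0$ and $n\ge1$. Put $\mathcal Z^n=(\mathbb Z_{\ge0})^n$, $\mathcal Z^n[\mathfrak m]=\{\vec m\in\mathcal Z^n: m_1+\dots+m_n=\mathfrak m\}$, $\mathbb C^n[2\mathfrak m]=\{\vec\Lambda\in\mathbb C^n:\Lambda_1+\dots+\Lambda_n=2\mathfrak m\}$. ''Generic'' parameters means: outside a countable union of zero loci of holomorphic functions that are not identically zero; $\vec\Lambda\in\mathbb C^n[2\mathfrak m]$ generic means $\Lambda_2,\dots,\Lambda_n$ generic in $\mathbb C$. $V_{n,\mathfrak m}$ is the complex vector space with basis $\{v^{(\vec m)}\}_{\vec m\in\mathcal Z^n[\mathfrak m]}$. A $V_{n,\mathfrak m}$-valued function of $\lambda\in\mathbb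 C$ is written $\varphi(\lambda)=\sum_{\vec m}\varphi_{\vec m}(\lambda)v^{(\vec m)}$. Resonance relations: a holomorphic $V_{n,\mathfrak m}$-valued function $\varphi(\lambda)$ satisfies the $n$-point resonance relations (at level $\mathfrak m$) with respect to $\vec\Lambda\in\mathbb C^n[2\mathfrak m]$ if for all $\vec m\in\mathcal Z^n[\mathfrak m]$: (1) for $j=1,\dots,n-1$ and $\delta\in\{1,\dots,m_j\}$, $\varphi_{\vec m}\big(-\delta+\sum_{i=j+1}^n(\Lambda_i-2m_i)\big)=\varphi_{\tau_j^\delta(\vec m)}\big(-\delta+\sum_{i=j+1}^n(\Lambda_i-2m_i)\big)$, where $\tau_j^\delta(\vec m)=(m_1,\dots,m_{j-1},m_j-\delta,m_{j+1}+\delta,m_{j+2},\dots,m_n)$; (2) for $\delta\in\{1,\dots,m_n\}$, $\varphi_{\vec m}(-\delta)=\varphi_{\tau_n^\delta(\vec m)}(\delta)$, where $\tau_n^\delta(\vec m)=(m_1+\delta,m_2,\dots,m_{n-1},m_n-\delta)$ (and $\tau_1^\delta(\vec m)=\vec m$ if $n=1$). *)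

(* Defs.v *)
From HB Require Import structures.
From mathcomp Require Import all_boot all_order all_algebra.
From mathcomp Require Import all_classical all_reals all_analysis.
From mathcomp Require Import complex.

Set Implicit Arguments.
Unset Strict Implicit.
Unset Printing Implicit Defensive.

Import Order.TTheory GRing.Theory Num.Theory.
Import numFieldNormedType.Exports.

Local Open Scope ring_scope.
Local Open Scope complex_scope.

Definition cexp (R : realType) (z : R[i]) : R[i] :=
  (expR (complex.Re z))%:C
    * (cos (complex.Im z) +i* sin (complex.Im z)).

Definition qpow (R : realType) (eta x : R[i]) : R[i] :=
  cexp ((0 +i* pi) * eta * x).

(* [differentiable] over the scalar field R[i] is Frechet differentiability
   with a complex linear differential. *)
Definition holomorphic (R : realType) (U : normedModType R[i])
    (f : U -> R[i]) : Prop :=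
  forall p : U, differentiable (f : U -> R[i]^o) p.

(* P holds outside a countable union of zero loci of entire functions that
   are not identically zero. *)
Definition generically (R : realType) (d : nat)
    (P : 'rV[R[i]]_d -> Prop) : Prop :=
  exists F : nat -> 'rV[R[i]]_d -> R[i],
    (forall k, holomorphic (F k) /\ exists p, F k p != 0) /\
    (forall p, (forall k, F k p != 0) -> P p).

(* Bounding the coordinates by M is no restriction, as they are nonnegative
   with sum M; it makes the type finite. *)
Definition weights (n M : nat) :=
  {m : {ffun 'I_n -> 'I_M.+1} | (\sum_(i < n) m i)%N == M}.

Definition Vspace (R : realType) (n M : nat) := {ffun weights n M -> R[i]}.

(* [ordS] is the cyclic successor, so that the last index n is followed by 1:
   this covers tau_1, ..., tau_(n-1) and tau_n, and is the identity for n = 1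
   (the subtraction is never truncated, as delta <= m_j is assumed). *)
Definition shift (n M : nat) (m : weights n M) (j : 'I_n) (delta : nat)
    (i : 'I_n) : nat :=
  (val m i - (if i == j then delta else 0)
     + (if i == ordS j then delta else 0))%N.

(* The default value m is only taken for delta > m_j, cf. [tauE]. *)
Definition tau (n M : nat) (m : weights n M) (j : 'I_n) (delta : nat) :
    weights n M :=
  insubd m [ffun i => inord (shift m j delta i)].

Lemma tauE (n M : nat) (m : weights n M) (j : 'I_n) (delta : nat) (i : 'I_n) :
  (delta <= val m j)%N -> val (tau m j delta) i = shift m j delta i :> nat.
Proof.
move=> dm.
have sM : (\sum_(i < n) shift m j delta i)%N = M.
  rewrite -[RHS](eqP (valP m)) big_split /= -big_mkcond big_pred1_eq.
  rewrite (bigD1 j) //= [in RHS](bigD1 j) //= eqxx addnAC subnK //.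
  by congr addn; apply: eq_bigr => k /negPf ->; rewrite subn0.
have sle k : (shift m j delta k < M.+1)%N.
  by rewrite ltnS -[leqRHS]sM (bigD1 k) //= leq_addr.
rewrite /tau val_insubd ifT ?ffunE ?inordK //.
by apply/eqP; rewrite -[RHS]sM; apply: eq_bigr => k _; rewrite ffunE inordK.
Qed.

(* phi lambda m is the coefficient of phi(lambda) at the basis vector v^(m);
   since V is finite dimensional, phi is holomorphic iff its coefficients are.
   The index j : 'I_n stands for j + 1 in 1, ..., n. *)
Definition resonance (R : realType) (n M : nat) (Lambda : 'rV[R[i]]_n)
    (phi : R[i] -> Vspace R n M) : Prop :=
  [/\ forall m : weights n M, holomorphic (fun lambda : R[i]^o => phi lambda m),
      forall (m : weights n M) (j : 'I_n) (delta : nat),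
        (j.+1 < n)%N -> (1 <= delta <= val m j)%N ->
        let lambda : R[i] :=
          - delta%:R + \sum_(i < n | (j < i)%N)
                         (Lambda 0 i - 2 * (val m i : nat)%:R) in
        phi lambda m = phi lambda (tau m j delta)
    & forall (m : weights n M) (j : 'I_n) (delta : nat),
        j.+1 = n -> (1 <= delta <= val m j)%N ->
        phi (- delta%:R) m = phi delta%:R (tau m j delta)].

(* The parameters (x, Lambda_2, ..., Lambda_n); Lambda_1 is determined by the
   prescribed sum of the Lambda_i. *)
Definition params (R : realType) (n : nat) (x : R[i]) (Lambda : 'rV[R[i]]_n) :
    'rV[R[i]]_n :=
  \row_(i < n) (if (i : nat) == 0%N then x else Lambda 0 i).

Definition quasi_poly (R : realType) (n M : nat) (eta x : R[i])
    (c : 'I_M.+1 -> Vspace R n M) (lambda : R[i]) : Vspace R n M :=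
  qpow eta (lambda * (x - M%:R))
    *: \sum_(k < M.+1) qpow eta (2 * k%:R * lambda) *: c k.

(* Main.v *)
Require Import Defs.
From HB Require Import structures.
From mathcomp Require Import all_boot all_order all_algebra.
From mathcomp Require Import all_classical all_reals all_analysis.
From mathcomp Require Import complex.
From mathcomp Require Import ring lra zify.

Set Implicit Arguments.
Unset Strict Implicit.
Unset Printing Implicit Defensive.

Import Order.TTheory GRing.Theory Num.Theory.
Import numFieldNormedType.Exports.

Local Open Scope ring_scope.
Local Open Scope complex_scope.

(** Put P_m(z) = sum_k z^k psi^(k)_m, a polynomial of degree at most M.  Since
    psi_m(lambda) = q^(lambda (x - M)) P_m(q^(2 lambda)), every resonance
    relation, indexed by a weight m and a pair r = (j, delta) with
    1 <= delta <= m_j, reads P_m(z) = w * P_(tau m)(z'), where z and z' are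
    exponentials of the two arguments and w = 1 unless j = n.  As the m_j add
    up to M there are M relations for every m, hence as many inhomogeneous
    linear equations as there are unknown coefficients psi^(k)_m, k >= 1.  The
    theorem thus amounts to the nonvanishing of one determinant, which is an
    entire function of (x, Lambda_2, ..., Lambda_n): outside its zero locus
    the system has exactly one solution ([exists_unique_of_det]).  That single
    entire function is the whole countable family that genericity asks for.

    It remains to find one point where the determinant does not vanish.  The
    parameter x only enters through the factor w of the relations j = n, which
    is a constant times t^delta with t = q^(2x).  So the determinant is a
    polynomial in t, and its value at t = 0 decides.  There the relations
    j = n say P_m(z) = 0, and the others relate P_m to P_(tau_j m) with j < n.
    As tau_j moves weight to the right, it increases sum_i i * m_i, and the
    system is triangular: by induction, a solution of the homogeneous system
    has P_m(z) = 0 at all M points z attached to m, besides P_m(0) = 0, so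
    P_m = 0 as soon as these points are distinct ([triangular_system_inj]).
    They are when Lambda_2 = ... = Lambda_n = 2M ([source_value_inj]), because
    q^(2a), for a an integer, determines a: its absolute value is
    exp(- 2 pi a Im eta).  Finally the nonzero polynomial in t does not vanish
    at all of the infinitely many points q^(2N), N natural.

    The holomorphy of the determinant, and of the components of psi, comes
    down to the complex differentiability of the exponential
    ([holomorphic_cexp]). *)

(** * The complex exponential is entire *)

Lemma cexpD (R : realType) (z w : R[i]) : cexp (z + w) = cexp z * cexp w.
Proof.
case: z w => [a b] [c d]; rewrite /cexp /= expRD cosD sinD.
by apply/eqP; rewrite eq_complex /=; apply/andP; split; apply/eqP; ring.
Qed.

Lemma cexp0 (R : realType) : cexp 0 = 1 :> R[i].
Proof.
by rewrite /cexp /= expR0 cos0 sin0 mul1r.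
Qed.

Lemma derive_near0 (R : realType) (f : R -> R) (l e : R) :
  is_derive (0 : R) (1 : R) f l -> 0 < e ->
  exists2 d : R, 0 < d & forall a, `|a| < d -> `|f a - f 0 - l * a| <= e * `|a|.
Proof.
move=> [df dl] e0.
have /eqaddoP/(_ _ e0) := derivable_nbhs df.
rewrite -nbhs_nearE dl => /nbhs_ballP[d /= d0 Hd]; exists d => // a ad.
have := Hd a; rewrite /ball /= sub0r normrN => /(_ ad).
rewrite -[(_ - _) a]/(f (a *: 1 + 0) - (f 0 + a *: l)).
by rewrite addr0 ![_ *: _]mulrC mul1r opprD addrA.
Qed.

Lemma normc_le_ReIm (R : realType) (z : R[i]) :
  `|z| <= (`|complex.Re z| + `|complex.Im z|)%:C.
Proof.
case: z => a b; rewrite normc_def /= lecR -[leRHS]ger0_norm ?addr_ge0//.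
rewrite -sqrtr_sqr ler_sqrt ?sqr_ge0//.
rewrite -(real_normK (num_real a)) -(real_normK (num_real b)).
have := normr_ge0 a; have := normr_ge0 b; nra.
Qed.

(** For h = a + ib and E = exp a, the difference has real part
    (E - 1)(cos b - 1) + (cos b - 1) + (E - 1 - a) and imaginary part
    (E - 1)(sin b - b) + (E - 1) b + (sin b - b); each of these six terms is
    small by the real derivatives of exp, cos and sin at 0. *)
Lemma cexp_near0 (R : realType) (e : R) : 0 < e ->
  exists2 d : R, 0 < d &
    forall h : R[i], `|h| < d%:C -> `|cexp h - 1 - h| <= e%:C * `|h|.
Proof.
(* One sixth of e for each of the six terms; e1 <= 1 absorbs the products. *)
move=> e0; pose e1 := Num.min 1 (e / 6).
have e10 : 0 < e1 by rewrite lt_min ltr01 divr_gt0.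
have e11 : e1 <= 1 by rewrite ge_min lexx.
have e1e : e1 <= e / 6 by rewrite ge_min lexx orbT.
have [d1 d10 H1] := derive_near0 (is_derive_expR 0) e10.
have [d2 d20 H2] := derive_near0 (is_derive_sin 0) e10.
have [d3 d30 H3] := derive_near0 (is_derive_cos 0) e10.
pose d := Num.min (Num.min d1 (e1 / 2)) (Num.min d2 d3).
exists d; first by rewrite !lt_min d10 d20 d30 divr_gt0.
move=> h hd; have hRe := normc_ge_Re h.
have hIm : `|complex.Im h|%:C <= `|h|.
  by rewrite normc_def lecR -sqrtr_sqr ler_sqrt ?lerDr ?addr_ge0 ?sqr_ge0.
have := le_lt_trans hRe hd; have := le_lt_trans hIm hd.
rewrite !ltcR !lt_min.
case: h hRe hIm {hd} => a b /= hRe hIm.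
move=> /andP[/andP[b1 b2] /andP[b3 b4]] /andP[/andP[a1 a2] /andP[a3 a4]].
have := H1 a a1; have := H2 b b3; have := H3 b b4.
rewrite expR0 cos0 sin0 => Hc Hs He; rewrite oppr0 mul0r subr0 in Hc.
rewrite mul1r subr0 in Hs; rewrite mul1r in He.
apply: le_trans (normc_le_ReIm _) _.
have -> : complex.Re (cexp (a +i* b) - 1 - (a +i* b)) =
   (expR a - 1) * (cos b - 1) + (cos b - 1) + (expR a - 1 - a).
  by rewrite /cexp /=; ring.
have -> : complex.Im (cexp (a +i* b) - 1 - (a +i* b)) =
   (expR a - 1) * (sin b - b) + (expR a - 1) * b + (sin b - b).
  by rewrite /cexp /=; ring.
move: hRe hIm; rewrite normc_def !lecR -rmorphM /= lecR.
set r := Num.sqrt _ => hRe hIm.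
have E : `|expR a - 1| <= e1.
  have -> : expR a - 1 = (expR a - 1 - a) + a by ring.
  apply: le_trans (ler_normD _ _) _.
  have := normr_ge0 a; nra.
have er : e1 * r <= e / 6 * r by rewrite ler_wpM2r ?sqrtr_ge0.
have Hc' : `|cos b - 1| <= e1 * r.
  by apply: le_trans Hc _; apply: ler_wpM2l => //; exact: ltW.
have Hs' : `|sin b - b| <= e1 * r.
  by apply: le_trans Hs _; apply: ler_wpM2l => //; exact: ltW.
have He' : `|expR a - 1 - a| <= e1 * r.
  by apply: le_trans He _; apply: ler_wpM2l => //; exact: ltW.
have Hb : `|(expR a - 1) * b| <= e1 * r by rewrite normrM ler_pM.
have small (y : R) : `|y| <= e1 * r -> `|(expR a - 1) * y| <= e1 * r.
  move=> yr; rewrite normrM -[leRHS]mul1r ler_pM //; exact: le_trans E e11.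
have := small _ Hc'; have := small _ Hs'.
move=> Hs2 Hc2; apply: (@le_trans _ _ (6 * (e1 * r))); last by lra.
have tri (x y z : R) : `|x| <= e1 * r -> `|y| <= e1 * r -> `|z| <= e1 * r ->
    `|x + y + z| <= 3 * (e1 * r).
  move=> hx hy hz; have := ler_normD (x + y) z; have := ler_normD x y; lra.
have := tri _ _ _ Hc2 Hc' He'; have := tri _ _ _ Hs2 Hb Hs'; lra.
Qed.

Lemma holomorphic_cexp (R : realType) :
  holomorphic (fun z : R[i]^o => cexp z).
Proof.
move=> z; apply/derivable1_diffP/cvg_ex; exists (cexp z).
apply/cvgrPdist_le => /= e e0.
pose K : R[i] := 1 + `|cexp z|.
have K0 : 0 < K by rewrite ltr_wpDr.
have eK0 : 0 < e / K by rewrite divr_gt0.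
have eKE : (complex.Re (e / K))%:C = e / K by rewrite RRe_real ?gtr0_real.
have [|d d0 Hd] := @cexp_near0 R (complex.Re (e / K)).
  by rewrite -ltcR eKE.
near=> t.
have t0 : t != 0 by near: t; exact: (@nbhs_dnbhs_neq R[i]^o 0).
have td : `|t| < d%:C by near: t; apply: (@dnbhs0_lt _ R[i]^o); rewrite ltcR.
have -> : cexp z - t^-1 *: (cexp (t%:A + z) - cexp z) =
    - (t^-1 * (cexp t - 1 - t) * cexp z).
  rewrite [t%:A]mulr1 cexpD /GRing.scale /=; field; exact: t0.
rewrite normrN normrM normrM normfV.
have nt0 : 0 < `|t : R[i]| by rewrite normr_gt0.
have H : `|t|^-1 * `|cexp t - 1 - t| <= e / K.
  by rewrite mulrC ler_pdivrMr // -eKE Hd.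
apply: le_trans (_ : e / K * `|cexp z| <= _);
  first exact: (ler_wpM2r (normr_ge0 _) H).
by rewrite mulrAC ler_pdivrMr // ler_pM2l // lerDr.
Unshelve. all: by end_near.
Qed.

(** * Square linear systems indexed by a finite type *)

Section LinearSystem.
Variables (T : finType) (F : fieldType).

(** Transposed, so that row vectors, on which [det0P] is phrased, are the
    candidate solutions. *)
Definition system_mx (A : comNzRingType) (f : T -> T -> A) : 'M[A]_#|T| :=
  \matrix_(i, j) f (enum_val j) (enum_val i).

Lemma mul_system_mx (f : T -> T -> F) (u : 'rV_#|T|) a :
  (u *m system_mx f) 0 (enum_rank a) = \sum_b f a b * u 0 (enum_rank b).
Proof.
rewrite mxE [RHS](reindex (@enum_val T T)); last exact/onW_bij/enum_val_bij.
by apply: eq_bigr => i _; rewrite mxE enum_rankK enum_valK mulrC.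
Qed.

Lemma system_mx_solvable (f : T -> T -> F) (r : T -> F) :
  \det (system_mx f) != 0 -> exists u, forall a, \sum_b f a b * u b = r a.
Proof.
rewrite -unitfE => fU.
pose v : 'rV_#|T| := (\row_i r (enum_val i)) *m invmx (system_mx f).
exists (fun b => v 0 (enum_rank b)) => a.
by rewrite -mul_system_mx mulmxKV // mxE enum_rankK.
Qed.

Lemma system_mx_det_neq0 (f : T -> T -> F) :
  (\det (system_mx f) != 0) <->
  (forall u, (forall a, \sum_b f a b * u b = 0) -> u =1 fun=> 0).
Proof.
split=> [fU u u0 b | f0].
  pose v : 'rV_#|T| := \row_i u (enum_val i).
  have : v == 0; last first.
    by move=> /eqP/rowP/(_ (enum_rank b)); rewrite !mxE enum_rankK.
  apply: contraNT fU => v0; apply/det0P; exists v => //; apply/rowP => l.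
  rewrite -[l]enum_valK mul_system_mx [RHS]mxE -[RHS](u0 (enum_val l)).
  by apply: eq_bigr => c _; rewrite mxE enum_rankK.
apply/det0P => -[v v0 vf]; case/negP: v0; apply/eqP/rowP => l.
rewrite mxE -[l]enum_valK (f0 (fun b => v 0 (enum_rank b))) // => a.
by rewrite -mul_system_mx vf mxE.
Qed.

End LinearSystem.

(** * Counting the relations of a weight *)

Section Relations.
Variables (n M : nat).
Implicit Types m : weights n.+1 M.

Definition relations m : seq ('I_n.+1 * nat) :=
  [seq (j, delta) | j <- enum 'I_n.+1, delta <- iota 1 (val m j)].

Lemma mem_relations m j delta :
  ((j, delta) \in relations m) = (1 <= delta <= val m j)%N.
Proof.
apply/allpairsPdep/idP => [[i [d [_ + [-> ->]]]]|jd].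
  by rewrite mem_iota add1n ltnS.
by exists j, delta; rewrite mem_enum mem_iota add1n ltnS.
Qed.

Lemma size_relations m : size (relations m) = M.
Proof.
rewrite size_allpairs_dep -[RHS](eqP (valP m)) sumnE big_map big_enum /=.
by apply: eq_bigr => i _; rewrite size_iota.
Qed.

Lemma uniq_relations m : uniq (relations m).
Proof.
apply: allpairs_uniq_dep => [|i _|]; rewrite ?enum_uniq ?iota_uniq //.
by move=> [i d] [i' d'] _ _ [-> ->].
Qed.

(** By [size_relations] the M relations of m can be numbered by 'I_M, which is
    also the range of the unknown coefficients psi^(1), ..., psi^(M) at m.  The
    default value is never taken. *)
Definition relation_at m (e : 'I_M) := nth (ord0, 0%N) (relations m) e.

Lemma relation_atP m r :
  reflect (exists e, relation_at m e = r) (r \in relations m).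
Proof.
apply: (iffP idP) => [rm|[e <-]]; last by rewrite mem_nth ?size_relations.
have lt_r : (index r (relations m) < M)%N.
  by rewrite -[ltnRHS](size_relations m) index_mem.
by exists (Ordinal lt_r); rewrite /relation_at nth_index.
Qed.

(** The quantity that tau_j increases for j < n: it orders the weights in a way
    that makes the degenerate system triangular. *)
Definition moment m := (\sum_(i < n.+1) i * val m i)%N.

Lemma moment_bound m : (moment m <= n * M)%N.
Proof.
rewrite -[in leqRHS](eqP (valP m)) big_distrr leq_sum // => i _.
by rewrite leq_mul2r -ltnS ltn_ord orbT.
Qed.

Lemma moment_tau m (j : 'I_n.+1) delta : (j.+1 < n.+1)%N ->
  (delta <= val m j)%N -> moment (tau m j delta) = (moment m + delta)%N.
Proof.
move=> jn dm; have Sj : ordS j = j.+1 :> nat by rewrite /= modn_small.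
rewrite /moment; under eq_bigr do rewrite tauE //.
rewrite /Defs.shift; under eq_bigr do rewrite mulnDr.
rewrite big_split /= [X in (_ + X)%N](bigD1 (ordS j)) //= eqxx.
rewrite [X in (_ + (_ + X))%N]big1 => [|i /negPf->]; last by rewrite muln0.
rewrite (bigD1 j) //= [in RHS](bigD1 j) //= eqxx.
under eq_bigr => i /negPf -> do rewrite subn0.
move: Sj => /= ->; rewrite addn0 mulSn addnCA addnC; congr addn.
by rewrite addnAC -mulnDr subnK.
Qed.

End Relations.

(** * The resonance system and its triangular degeneration *)

Section Triangular.
Variables (F : fieldType) (n M : nat).
Local Notation weight := (weights n.+1 M).
Local Notation rel := ('I_n.+1 * nat)%type.

(** With u (m, k) standing for psi^(k+1)_m, this is P_m(z) - P_m(0). *)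
Definition tail_eval (u : weight * 'I_M -> F) (m : weight) (z : F) :=
  \sum_(k < M) z ^+ k.+1 * u (m, k).

Definition target (m : weight) (r : rel) := tau m r.1 r.2.

(** The row a = (m, e) of the system is the relation number e of m, namely
    P_m(z) - w * P_(tau m)(z'); the column b = (m', k) is the unknown
    psi^(k+1)_m'.  The two terms may concern the same unknown, since tau_j is
    the identity when there is a single point.  The coefficients range over a
    ring so that t = q^(2x) can be an indeterminate. *)
Definition resonance_coef (A : comNzRingType) (z w z' : weight -> rel -> A)
    (a b : weight * 'I_M) : A :=
  let r := relation_at a.1 a.2 in
  z a.1 r ^+ b.2.+1 *+ (b.1 == a.1)
  - w a.1 r * z' a.1 r ^+ b.2.+1 *+ (b.1 == target a.1 r).

Lemma rmorph_resonance_coef (A B : comNzRingType) (f : {rmorphism A -> B})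
    (z w z' : weight -> rel -> A) a b :
  f (resonance_coef z w z' a b) =
  resonance_coef (fun m r => f (z m r)) (fun m r => f (w m r))
    (fun m r => f (z' m r)) a b.
Proof.
by rewrite /resonance_coef rmorphB !rmorphMn rmorphM !rmorphXn.
Qed.

Lemma sum_resonance_coef z w z' (u : weight * 'I_M -> F) a :
  let r := relation_at a.1 a.2 in
  \sum_b resonance_coef z w z' a b * u b =
  tail_eval u a.1 (z a.1 r) - w a.1 r * tail_eval u (target a.1 r) (z' a.1 r).
Proof.
move=> r; set m' := target _ _; pose f m (k : 'I_M) :=
  z a.1 r ^+ k.+1 * u (m, k) *+ (m == a.1)
  - w a.1 r * (z' a.1 r ^+ k.+1 * u (m, k) *+ (m == m')).
transitivity (\sum_m \sum_k f m k).
  rewrite pair_big; apply: eq_bigr => -[m k] _ /=.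
  rewrite /resonance_coef -/r /= -/m' /f mulrBl !mulrnAl mulrnAr.
  by rewrite mulrA.
rewrite exchange_big /tail_eval mulr_sumr -sumrB; apply: eq_bigr => k _.
rewrite sumrB -mulr_sumr; under eq_bigr do rewrite -mulr_natr mulrb.
rewrite (bigD1 a.1) //= eqxx mulr1 big1 ?addr0 => [|i /negPf->]; last first.
  by rewrite mulr0.
rewrite (bigD1 m') //= eqxx mulr1n big1 ?addr0 // => i /negPf->.
by rewrite mulr0n.
Qed.

(** The tail of P_m is z times a polynomial of degree less than M. *)
Lemma tail_eval_inj (u : weight * 'I_M -> F) m (s : seq F) :
  size s = M -> uniq s -> 0 \notin s ->
  (forall z, z \in s -> tail_eval u m z = 0) -> forall k, u (m, k) = 0.
Proof.
move=> sM us s0 su k.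
pose p := rVpoly (\row_(k < M) u (m, k)).
have pE z : tail_eval u m z = z * p.[z].
  rewrite (@horner_coef_wide _ M) ?size_poly // mulr_sumr.
  by apply: eq_bigr => i _; rewrite coef_rVpoly_ord mxE exprS mulrCA mulrC.
have <- : p`_k = u (m, k) by rewrite coef_rVpoly_ord mxE.
suff -> : p = 0 by rewrite coef0.
apply: contraTeq isT => p0; have := max_poly_roots p0 _ us.
rewrite sM ltnNge size_poly => -> //; apply/allP => z zs; apply/eqP.
have z0 : z != 0 by apply: contraNneq s0 => <-.
by apply: (mulfI z0); rewrite -pE su // mulr0.
Qed.

(** Induction on decreasing moment: once P_m' = 0 for all m' of larger moment,
    the right-hand sides of all the relations of m vanish, those with j < n by
    induction and those with j = n because w = 0.  Hence P_m vanishes at its M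
    points z. *)
Lemma triangular_system_inj (z w z' : weight -> rel -> F) :
  (forall (m : weight) (j : 'I_n.+1) delta,
     j.+1 = n.+1 -> (1 <= delta <= val m j)%N -> w m (j, delta) = 0) ->
  (forall m, {in relations m &, injective (z m)}) ->
  (forall m r, z m r != 0) ->
  forall u, (forall a, \sum_b resonance_coef z w z' a b * u b = 0) ->
    u =1 fun=> 0.
Proof.
move=> w0 z_inj z0 u u0.
suff u_m N m : (n * M - moment m < N)%N -> forall k, u (m, k) = 0.
  by move=> [m k]; exact: u_m (ltnSn _) k.
elim: N m => // N IH m mN.
apply: (@tail_eval_inj _ _ [seq z m r | r <- relations m]).
- by rewrite size_map size_relations.
- by rewrite map_inj_in_uniq ?uniq_relations //; exact: z_inj.
- by apply/mapP => -[r _ /esym/eqP]; apply/negP.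
move=> _ /mapP[r rm ->]; have /relation_atP[e re] := rm.
have := u0 (m, e); rewrite sum_resonance_coef /= re => /eqP.
rewrite subr_eq0 => /eqP ->; case: r rm {re} => j delta.
rewrite mem_relations => jd; have [jn|jn] := eqVneq j.+1 n.+1.
  by rewrite w0 // mul0r.
rewrite /tail_eval big1 ?mulr0 // => k _; rewrite /target /= IH ?mulr0 //.
have jn' : (j.+1 < n.+1)%N by rewrite ltn_neqAle jn ltn_ord.
have /andP[d0 dm] := jd.
have := moment_bound (tau m j delta); rewrite moment_tau //; lia.
Qed.

End Triangular.

(** * Closure properties of holomorphic functions *)

Section Holomorphic.
Variables (R : realType) (U : normedModType R[i]).
Implicit Types f g : U -> R[i].

Lemma holomorphic_cst (a : R[i]) : holomorphic (fun _ : U => a).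
Proof. by move=> p; exact: differentiable_cst. Qed.

Lemma holomorphicD f g :
  holomorphic f -> holomorphic g -> holomorphic (fun p => f p + g p).
Proof. by move=> hf hg p; exact: differentiableD (hf p) (hg p). Qed.

Lemma holomorphicM f g :
  holomorphic f -> holomorphic g -> holomorphic (fun p => f p * g p).
Proof. by move=> hf hg p; exact: differentiableM (hf p) (hg p). Qed.

Lemma holomorphicN f : holomorphic f -> holomorphic (fun p => - f p).
Proof. by move=> hf p; exact: differentiableN (hf p). Qed.

Lemma holomorphicB f g :
  holomorphic f -> holomorphic g -> holomorphic (fun p => f p - g p).
Proof. by move=> hf hg; exact: holomorphicD hf (holomorphicN hg). Qed.

Lemma holomorphic_sum (I : Type) (r : seq I) (P : pred I)
    (f : I -> U -> R[i]) :
  (forall k, P k -> holomorphic (f k)) ->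
  holomorphic (fun p => \sum_(k <- r | P k) f k p).
Proof.
move=> hf; elim: r => [|k r IH].
  under eq_fun do rewrite big_nil.
  exact: holomorphic_cst.
under eq_fun do rewrite big_cons.
by case Pk: (P k) => //; apply: holomorphicD => //; exact: hf.
Qed.

Lemma holomorphic_prod (I : Type) (r : seq I) (f : I -> U -> R[i]) :
  (forall k, holomorphic (f k)) ->
  holomorphic (fun p => \prod_(k <- r) f k p).
Proof.
move=> hf; elim: r => [|k r IH].
  under eq_fun do rewrite big_nil.
  exact: holomorphic_cst.
under eq_fun do rewrite big_cons.
exact: holomorphicM (hf k) IH.
Qed.

Lemma holomorphicX f k : holomorphic f -> holomorphic (fun p => f p ^+ k).
Proof.
move=> hf; elim: k => [|k IH]; first exact: holomorphic_cst.
under eq_fun do rewrite exprS.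
exact: holomorphicM.
Qed.

Lemma holomorphicMn f k : holomorphic f -> holomorphic (fun p => f p *+ k).
Proof.
move=> hf; under eq_fun do rewrite -mulr_natr.
by apply: holomorphicM => //; exact: holomorphic_cst.
Qed.

Lemma holomorphic_det k (A : U -> 'M[R[i]]_k) :
  (forall a b, holomorphic (fun p => A p a b)) ->
  holomorphic (fun p => \det (A p)).
Proof.
move=> hA; apply: holomorphic_sum => s _; apply: holomorphicM.
  exact: holomorphic_cst.
by apply: holomorphic_prod.
Qed.

Lemma holomorphic_qpow (eta : R[i]) f :
  holomorphic f -> holomorphic (fun p => qpow eta (f p)).
Proof.
move=> hf p.
apply: (@differentiable_comp _ _ R[i]^o R[i]^o
  (fun p => (0 +i* pi) * eta * f p) (fun z => cexp z)).
  exact: holomorphicM (holomorphic_cst _) hf p.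
exact: holomorphic_cexp.
Qed.

End Holomorphic.

Lemma holomorphic_id (R : realType) : holomorphic (fun z : R[i]^o => z).
Proof. by move=> z; have [] := is_diff_id z. Qed.

(** * The function q^x *)

Section Qpow.
Variables (R : realType) (eta : R[i]).
Local Notation q := (qpow eta).

Lemma qpowD (x y : R[i]) : q (x + y) = q x * q y.
Proof. by rewrite /qpow mulrDr cexpD. Qed.

Lemma qpow0 : q 0 = 1.
Proof. by rewrite /qpow mulr0 cexp0. Qed.

Lemma qpow_neq0 (x : R[i]) : q x != 0.
Proof.
have : q x * q (- x) != 0 by rewrite -qpowD subrr qpow0 oner_neq0.
by rewrite mulf_eq0 negb_or => /andP[].
Qed.

Lemma qpowMn (k : nat) (x : R[i]) : q (k%:R * x) = q x ^+ k.
Proof.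
elim: k => [|k IH]; first by rewrite mul0r qpow0.
by rewrite -natr1 mulrDl mul1r qpowD IH exprSr.
Qed.

Lemma normc_cexp (z : R[i]) : `|cexp z| = (expR (complex.Re z))%:C.
Proof.
rewrite /cexp normrM !normc_def /= expr0n /= addr0 sqrtr_sqr cos2Dsin2 sqrtr1.
by rewrite mulr1 ger0_norm ?expR_ge0.
Qed.

(** The absolute value of q^(2a) is exp (- 2 pi a Im eta). *)
Lemma qpow_int_inj : 0 < complex.Im eta ->
  injective (fun a : int => q (2 * a%:~R)).
Proof.
move=> eta0 a b /(congr1 Num.norm); rewrite !normc_cexp => -[] /expR_inj.
have E (x : int) : complex.Re ((0 +i* pi) * eta * (2 * x%:~R)) =
    (- (2 * pi * complex.Im eta)) * x%:~R.
  have -> : (x%:~R : R[i]) = (x%:~R)%:C by rewrite rmorph_int.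
  by case: (eta) => c d /=; ring.
rewrite !E => /mulfI E1; apply/eqP; rewrite -(eqr_int R) E1 // oppr_eq0.
by rewrite !mulf_neq0 // ?gt_eqF ?pi_gt0.
Qed.

End Qpow.

(** * Resonance relations as a linear system *)

Section ResonanceSystem.
Variables (R : realType) (eta : R[i]) (n M : nat).
Local Notation weight := (weights n.+1 M).
Local Notation rel := ('I_n.+1 * nat)%type.
Local Notation q := (qpow eta).
Implicit Types (p Lambda : 'rV[R[i]]_n.+1) (m : weight) (r : rel).

Definition wraps r := r.1.+1 == n.+1.

(** For j = n the sum is empty and the node is - delta, so that the two families
    of relations only differ by [target_node]. *)
Definition node p m r : R[i] :=
  - r.2%:R + \sum_(i < n.+1 | (r.1 < i)%N) (p 0 i - 2 * (val m i : nat)%:R).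

Definition target_node p m r := if wraps r then - node p m r else node p m r.

Definition source_value p m r := q (2 * node p m r).
Definition target_value p m r := q (2 * target_node p m r).
Definition factor p m r :=
  q ((target_node p m r - node p m r) * (p 0 0 - M%:R)).

Definition resonance_matrix p :=
  system_mx (resonance_coef (source_value p) (factor p) (target_value p)).

Lemma node_wraps p m r : wraps r -> node p m r = - r.2%:R.
Proof.
move=> /eqP rn; rewrite /node big_pred0 ?addr0 // => i.
by apply/negbTE; rewrite -leqNgt -ltnS rn ltn_ord.
Qed.

Lemma eq_node p p' m r : (forall i : 'I_n.+1, (0 < i)%N -> p 0 i = p' 0 i) ->
  node p m r = node p' m r.
Proof.
move=> pp'; congr (_ + _); apply: eq_bigr => i ri; rewrite pp' //.
exact: leq_ltn_trans ri.
Qed.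

Lemma resonanceP Lambda (phi : R[i] -> Vspace R n.+1 M) :
  resonance Lambda phi <->
  (forall m, holomorphic (fun lambda : R[i]^o => phi lambda m)) /\
  (forall m r, r \in relations m ->
     phi (node Lambda m r) m = phi (target_node Lambda m r) (target m r)).
Proof.
split=> [[hol inner wrap]|[hol rel_eq]].
  split=> // m [j d]; rewrite mem_relations => jd; rewrite /target_node.
  case: ifPn => [jn|jn].
    by rewrite node_wraps //= opprK; apply: wrap => //; exact/eqP.
  by apply: inner => //; rewrite ltn_neqAle jn ltn_ord.
split=> // m j d jn jd.
  have := rel_eq m (j, d); rewrite mem_relations /target_node => /(_ jd).
  by rewrite ifN // /wraps /= neq_ltn jn.
have jn' : wraps (j, d) by rewrite /wraps /= jn.
have := rel_eq m (j, d); rewrite mem_relations /target_node => /(_ jd).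
by rewrite jn' node_wraps //= opprK.
Qed.

Lemma holomorphic_det_resonance :
  holomorphic (fun p => \det (resonance_matrix p)).
Proof.
have h_node m r : holomorphic (fun p => node p m r).
  apply: holomorphicD; first exact: holomorphic_cst.
  apply: holomorphic_sum => i _; apply: holomorphicB.
    by move=> p; exact: differentiable_coord.
  exact: holomorphic_cst.
have h_tnode m r : holomorphic (fun p => target_node p m r).
  by rewrite /target_node; case: (wraps r) => //; exact: holomorphicN.
have h2 f : holomorphic f -> holomorphic (fun p : 'rV_n.+1 => q (2 * f p)).
  by move=> hf; apply/holomorphic_qpow/holomorphicM.
apply: holomorphic_det => a b; under eq_fun do rewrite mxE.
apply: holomorphicB.
  by apply: holomorphicMn; apply: holomorphicX; apply: h2.
apply: holomorphicMn; apply: holomorphicM; last first.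
  by apply: holomorphicX; apply: h2.
apply: holomorphic_qpow; apply: holomorphicM; first exact: holomorphicB.
apply: holomorphicB; last exact: holomorphic_cst.
by move=> p; exact: differentiable_coord.
Qed.

Definition coefs_of_tail (c0 : Vspace R n.+1 M) (u : weight * 'I_M -> R[i])
    (k : 'I_M.+1) : Vspace R n.+1 M :=
  if unlift ord0 k is Some l then [ffun m => u (m, l)] else c0.

Definition tail (c : 'I_M.+1 -> Vspace R n.+1 M) (b : weight * 'I_M) : R[i] :=
  c (lift ord0 b.2) b.1.

Lemma tail_coefs c0 u : tail (coefs_of_tail c0 u) =1 u.
Proof. by move=> [m k]; rewrite /tail /coefs_of_tail liftK ffunE. Qed.

Lemma quasi_polyE (x : R[i]) c (lambda : R[i]) m :
  quasi_poly eta x c lambda m =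
  q (lambda * (x - M%:R)) *
    (c ord0 m + tail_eval (tail c) m (q (2 * lambda))).
Proof.
rewrite /quasi_poly ffunE; congr (_ * _).
rewrite sum_ffunE big_ord_recl ffunE mulr0 mul0r qpow0 /=.
rewrite /GRing.scale /= mul1r; congr (_ + _); apply: eq_bigr => k _.
rewrite ffunE; congr (_ * _).
by rewrite -qpowMn mulrA [2 * _]mulrC.
Qed.

(** Dividing by the nonzero prefactor q^(lambda (x - M)) of the left-hand side
    leaves a relation between the polynomials P_m, in which the initial
    coefficient is moved to the right. *)
Lemma quasi_poly_relation p (x : R[i]) Lambda c m r : p = params x Lambda ->
  let psi := quasi_poly eta x c in
  (psi (node Lambda m r) m = psi (target_node Lambda m r) (target m r)) <->
  (tail_eval (tail c) m (source_value p m r)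
     - factor p m r * tail_eval (tail c) (target m r) (target_value p m r)
   = factor p m r * c ord0 (target m r) - c ord0 m).
Proof.
move=> pE psi; rewrite /psi !quasi_polyE.
have nE : node Lambda m r = node p m r.
  by apply: eq_node => i; rewrite pE mxE; case: eqP => // ->.
rewrite /factor /source_value /target_value /target_node nE.
rewrite -/(target_node p m r).
have -> : p 0 0 = x by rewrite pE mxE.
set l := node _ _ _; set l' := target_node _ _ _.
have -> : q (l' * (x - M%:R)) = q (l * (x - M%:R)) * q ((l' - l) * (x - M%:R)).
  by rewrite -qpowD -mulrDl [l + _]addrC subrK.
set A := c ord0 m; set B := c ord0 _; set T := tail_eval _ _ _.
set S := tail_eval _ _ _; set W := q ((l' - l) * _).
rewrite -mulrA; split=> [/(mulfI (qpow_neq0 _ _)) E|E]; last congr (_ * _).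
  have -> : T = W * (B + S) - A by rewrite -E addrC addKr.
  by ring.
have -> : T = W * B - A + W * S by rewrite -E subrK.
by ring.
Qed.

Lemma resonance_quasi_poly p (x : R[i]) Lambda c : p = params x Lambda ->
  resonance Lambda (quasi_poly eta x c) <->
  forall a, let r := relation_at a.1 a.2 in
    \sum_b resonance_coef (source_value p) (factor p) (target_value p) a b
       * tail c b
    = factor p a.1 r * c ord0 (target a.1 r) - c ord0 a.1.
Proof.
move=> pE; rewrite resonanceP; split=> [[_ rel_eq] [m e] /=|sys].
  rewrite sum_resonance_coef /=; apply/(quasi_poly_relation _ _ _ pE).
  by apply: rel_eq; apply/relation_atP; exists e.
split=> [m|m r /relation_atP[e <-]].
  under eq_fun do rewrite quasi_polyE.
  have hid := @holomorphic_id R.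
  apply: holomorphicM.
    by apply/holomorphic_qpow/holomorphicM.
  apply: holomorphicD; first exact: holomorphic_cst.
  apply: holomorphic_sum => k _.
  apply: holomorphicM; last exact: holomorphic_cst.
  apply/holomorphicX/holomorphic_qpow/holomorphicM => //.
apply/(quasi_poly_relation _ _ _ pE).
by have := sys (m, e); rewrite sum_resonance_coef.
Qed.

(** The initial coefficient prescribes the right-hand side of the system; the
    remaining coefficients form its solution. *)
Lemma exists_unique_of_det p (x : R[i]) Lambda psi0 :
  p = params x Lambda -> \det (resonance_matrix p) != 0 ->
  exists! psi : R[i] -> Vspace R n.+1 M,
    (exists c : 'I_M.+1 -> Vspace R n.+1 M,
       c ord0 = psi0 /\ psi = quasi_poly eta x c) /\ resonance Lambda psi.
Proof.
move=> pE det0.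
have [u uP] := system_mx_solvable
  (fun a => let r := relation_at a.1 a.2 in
     factor p a.1 r * psi0 (target a.1 r) - psi0 a.1) det0.
have c0 : coefs_of_tail psi0 u ord0 = psi0.
  by rewrite /coefs_of_tail unlift_none.
exists (quasi_poly eta x (coefs_of_tail psi0 u)); split.
  split; first by exists (coefs_of_tail psi0 u).
  apply/(resonance_quasi_poly _ pE) => a /=; rewrite c0 -[RHS]uP.
  by apply: eq_bigr => b _; rewrite tail_coefs.
move=> _ [[c [c0' ->]] /(resonance_quasi_poly _ pE) sys].
congr quasi_poly; apply/funext => k; rewrite /coefs_of_tail.
case: unliftP => [l ->|->] //; apply/ffunP => m; rewrite ffunE.
have /system_mx_det_neq0/(_ (fun b => u b - tail c b)) inj := det0.
apply/eqP; rewrite -subr_eq0; apply/eqP; apply: (inj _ (m, l)) => a.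
under eq_bigr do rewrite mulrBr.
by rewrite sumrB uP sys /= c0' subrr.
Qed.

End ResonanceSystem.

(** * A point where the determinant does not vanish *)

Section NonVanishing.
Variables (R : realType) (eta : R[i]) (heta : 0 < complex.Im eta) (n M : nat).
Local Notation weight := (weights n.+1 M).
Local Notation rel := ('I_n.+1 * nat)%type.
Local Notation q := (qpow eta).
Implicit Types (m : weight) (r : rel).

(** The test parameters x = N and Lambda_2 = ... = Lambda_n = 2M. *)
Definition base_point (N : nat) : 'rV[R[i]]_n.+1 :=
  \row_i (if i == 0 then N%:R else (2 * M)%:R).

Definition tail_weight m (j : 'I_n.+1) :=
  (\sum_(i < n.+1 | (j < i)%N) 2 * (M - val m i))%N.

Lemma weight_le m i : (val m i <= M)%N.
Proof. by rewrite -[leqRHS](eqP (valP m)) (bigD1 i) //= leq_addr. Qed.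

Lemma weight_pair_le m i j : i != j -> (val m i + val m j <= M)%N.
Proof.
move=> ij; rewrite -[leqRHS](eqP (valP m)) (bigD1 i) //= (bigD1 j) 1?eq_sym //=.
by rewrite addnA leq_addr.
Qed.

Lemma tail_weight_gap m (i j : 'I_n.+1) : (i < j)%N ->
  (tail_weight m j + 2 * (M - val m j) <= tail_weight m i)%N.
Proof.
move=> ij; rewrite /tail_weight [leqRHS](bigD1 j) //= addnC leq_add2l.
rewrite big_mkcond [leqRHS]big_mkcond; apply: leq_sum => k _.
case: ifPn => // jk; rewrite ifT // (ltn_trans ij jk) /=.
by apply: contraTneq jk => ->; rewrite ltnn.
Qed.

Lemma node_base_point N m r :
  node (base_point N) m r = ((tail_weight m r.1)%:Z - r.2%:Z)%:~R.
Proof.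
rewrite /node addrC rmorphB /= -!pmulrn; congr (_ - _).
rewrite /tail_weight natr_sum; apply: eq_bigr => i ri.
rewrite mxE ifN; last by apply: contraTneq ri => ->.
by rewrite !natrM natrB ?weight_le // mulrBr.
Qed.

(** The points z of m are q^(2a) with a = sum_(i > j) 2 (M - m_i) - delta.  For
    j < j' the two sums differ by at least 2 (M - m_j') >= 2 m_j, which exceeds
    the difference delta - delta' < m_j. *)
Lemma source_value_inj N m :
  {in relations m &, injective (source_value eta (base_point N) m)}.
Proof.
move=> [j d] [j' d']; rewrite !mem_relations => /andP[d0 dm] /andP[d'0 d'm].
rewrite /source_value !node_base_point => /(qpow_int_inj heta) /= E.
have [jj|jj|/val_inj jj] := ltngtP j j'; last first.
- by move: E; rewrite jj => E; congr (_, _); lia.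
- have := tail_weight_gap m jj; have := @weight_pair_le m j j'.
  by rewrite neq_ltn jj orbT => /(_ isT); lia.
- have := tail_weight_gap m jj; have := @weight_pair_le m j j'.
  by rewrite neq_ltn jj => /(_ isT); lia.
Qed.

(** The factor w at x = N as a polynomial in t = q^(2N). *)
Definition factor_poly m r : {poly R[i]} :=
  if wraps r then q (- (2 * r.2%:R * M%:R)) *: 'X^(r.2) else 1.

Definition resonance_poly : {poly R[i]} :=
  \det (system_mx (resonance_coef
    (fun m r => (source_value eta (base_point 0) m r)%:P)
    factor_poly
    (fun m r => (target_value eta (base_point 0) m r)%:P))).

Lemma horner_resonance_poly t : resonance_poly.[t] =
  \det (system_mx (resonance_coef (source_value eta (base_point 0))
    (fun m r => (factor_poly m r).[t]) (target_value eta (base_point 0)))).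
Proof.
rewrite -horner_evalE -det_map_mx; congr (\det _).
apply/matrixP => a b; rewrite !mxE rmorph_resonance_coef.
by rewrite /resonance_coef /= !horner_evalE !hornerC.
Qed.

(** At t = 0 the factors of the relations j = n vanish, as delta >= 1. *)
Lemma resonance_poly_neq0 : resonance_poly != 0.
Proof.
apply/eqP => d0; have := horner_resonance_poly 0.
rewrite d0 horner0 => /esym/eqP; apply/negP/system_mx_det_neq0.
apply: triangular_system_inj => [m j d jn /andP[dpos _]|m|m r].
- rewrite /factor_poly /wraps /= jn eqxx hornerZ hornerXn expr0n gtn_eqF //.
  by rewrite mulr0.
- exact: source_value_inj.
- exact: qpow_neq0.
Qed.

Lemma det_base_point N :
  \det (resonance_matrix eta M (base_point N)) = resonance_poly.[q (2 * N%:R)].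
Proof.
have nE m r : node (base_point N) m r = node (base_point 0) m r.
  by rewrite !node_base_point.
have tE m r : target_node (base_point N) m r = target_node (base_point 0) m r.
  by rewrite /target_node nE.
rewrite horner_resonance_poly; congr (\det _); apply/matrixP => a b.
rewrite !mxE /resonance_coef /source_value /target_value !nE !tE.
congr (_ - _ * _ *+ _); rewrite /factor /factor_poly /target_node nE mxE /=.
case: ifPn => [rw|_]; last by rewrite subrr mul0r qpow0 hornerC.
rewrite node_wraps // opprK hornerZ hornerXn -qpowMn -qpowD.
by congr (q _); ring.
Qed.

(** The points q^(2N) are distinct, so the polynomial is nonzero at one of them. *)
Lemma det_resonance_neq0 :
  exists p : 'rV[R[i]]_n.+1, \det (resonance_matrix eta M p) != 0.
Proof.
have [N dN] : exists N : nat, resonance_poly.[q (2 * N%:R)] != 0.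
  pose s := [seq q (2 * N%:R) | N <- iota 0 (size resonance_poly)].
  have us : uniq s.
    rewrite map_inj_uniq ?iota_uniq // => a b ab.
    by have [] := @qpow_int_inj _ _ heta a b ab.
  have := contraNN (fun h => max_poly_roots resonance_poly_neq0 h us).
  rewrite size_map size_iota ltnn => /(_ isT)/allPn[_ /mapP[N _ ->] rN].
  by exists N.
by exists (base_point N); rewrite det_base_point.
Qed.

End NonVanishing.

(** * Generic existence and uniqueness *)

Theorem theorem2p1 (R : realType) (eta : R[i]) (heta : 0 < complex.Im eta)
    (M n : nat) (hn : (1 <= n)%N) :
  generically (fun p : 'rV[R[i]]_n =>
    forall (x : R[i]) (Lambda : 'rV[R[i]]_n),
      \sum_(i < n) Lambda 0 i = 2 * M%:R ->
      p = params x Lambda ->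
      forall psi0 : Vspace R n M,
        exists! psi : R[i] -> Vspace R n M,
          (exists c : 'I_M.+1 -> Vspace R n M,
             c ord0 = psi0 /\ psi = quasi_poly eta x c)
          /\ resonance Lambda psi).
Proof.
case: n hn => // n _.
exists (fun _ p => \det (resonance_matrix eta M p)); split=> [_|p pD].
  split; [exact: holomorphic_det_resonance | exact: det_resonance_neq0].
move=> x Lambda _ pE psi0; exact: exists_unique_of_det pE (pD 0%N).
Qed.
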